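(* Let $\mu>0$, $1\le p<+\infty$ and $f\in L^p([0,1])$. Then for every sufficiently large $n\in\mathbb{N}$, $$\|\mathscr{L}_n^K f-f\|_p\le \frac{\ln(2+\mu)}{\ln(1+\mu)}(K_\mu+1)\,\mathcal{K}(f,\Lambda_n)_p,$$ where $K_\mu:=1+\frac{1}{1+\mu}$, $\Lambda_n:=\frac{\ln(2+\mu)}{\ln(1+\mu)}\left(1+\frac{1}{(1+\mu)\ln(1+\mu)}\right)(K_\mu+1)^{-1}T_n$, $T_n:=\frac{1}{2(n+1)}+\frac{\sqrt2}{\sqrt{n+1}}+\gamma_n$ and $\gamma_n:=\max_{x\in[0,1]}|a_{n+1}(x)-x|$.
   Context: Fix $\mu>0$. Let $\ln_\mu(x):=\ln(1+\mu+x)$ for $x\in[0,1]$, and for $f:[0,1]\to\mathbb{R}$ let $f_\mu(x):=f(x)/\ln_\mu(x)$. Let $p_{n,k}(y):=\binom{n}{k}y^k(1-y)^{n-k}$ and $a_{n+1}(x):=\dfrac{\ln\left(1+\frac{x}{(n+1)(1+\mu)}\right)}{\ln\left(1+\frac{1}{(n+1)(1+\mu)}\right)}$, $x\in[0,1]$. For $n\in\mathbb{N}$ define $\mathscr{L}_n^K f(x):=\ln_\mu(x)\sum_{k=0}^n p_{n,k}(a_{n+1}(x))\,(n+1)\int_{k/(n+1)}^{(k+1)/(n+1)} f_\mu(t)\,dt$, $x\in[0,1]$. The Peetre $K$-functional is $\mathcal{K}(f,t)_p:=\inf_{g\in C^1([0,1])}\{\|f-g\|_p+t\|g\|_{C^1}\}$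 for $t>0$, where $\|g\|_{C^1}:=\|g\|_\infty+\|g'\|_\infty$ and $\|\cdot\|_p$ is the usual $L^p([0,1])$ norm. *)

(* Defs.v *)
From HB Require Import structures.
From mathcomp Require Import all_boot all_order all_algebra.
From mathcomp Require Import all_classical all_reals all_analysis.
Set Implicit Arguments. Unset Strict Implicit. Unset Printing Implicit Defensive.
Import Order.TTheory GRing.Theory Num.Theory.
Import numFieldNormedType.Exports.
Local Open Scope classical_set_scope.
Local Open Scope ring_scope.

Section Defs.
Variable R : realType.
Implicit Types (mu p t x y : R) (f g : R -> R).

Definition leb := (@lebesgue_measure R).

Definition lnmu mu x : R := ln (1 + mu + x).

Definition fmu mu f x : R := f x / lnmu mu x.

Definition pnk (n k : nat) y : R := ('C(n, k))%:R * y ^+ k * (1 - y) ^+ (n - k).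

(* a_{n+1}(x) ; the argument m stands for n+1 *)
Definition a_ mu (m : nat) x : R :=
  ln (1 + x / (m%:R * (1 + mu))) / ln (1 + 1 / (m%:R * (1 + mu))).

Definition integ (a b : R) f : R := fine (\int[leb]_(t in `[a, b]) (f t)%:E)%E.

Definition LK mu (n : nat) f x : R :=
  lnmu mu x * \sum_(0 <= k < n.+1)
     (pnk n k (a_ mu n.+1 x) * n.+1%:R *
      integ (k%:R / n.+1%:R) (k.+1%:R / n.+1%:R) (fmu mu f)).

Definition Lpnorm p f : \bar R :=
  ((\int[leb]_(x in `[0%R, 1%R]) (`|(f x)%:E| `^ p)) `^ p^-1)%E.

Definition inLp p f : Prop :=
  measurable_fun (`[0, 1] : set R) f /\
  (\int[leb]_(x in `[0%R, 1%R]) (`|(f x)%:E| `^ p) < +oo)%E.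

Definition supnorm01 g : R := sup [set `|g x| | x in `[0, 1]].

(* C^1([0,1]) (functions are taken on R, C^1 everywhere; every C^1 function on
   [0,1] is the restriction of such a function) *)
Definition C1 g : Prop := (forall x, derivable g x 1) /\ continuous (derive1 g).

Definition C1norm g : R := supnorm01 g + supnorm01 (derive1 g).

Definition Kfun p f t : \bar R :=
  ereal_inf [set (Lpnorm p (fun x => f x - g x)%R + (t * C1norm g)%:E)%E | g in C1].

Definition Kmu mu : R := 1 + 1 / (1 + mu).

Definition gamma_ mu (n : nat) : R := sup [set `|a_ mu n.+1 x - x| | x in `[0, 1]].

Definition T_ mu (n : nat) : R :=
  1 / (2 * n.+1%:R) + Num.sqrt 2 / Num.sqrt n.+1%:R + gamma_ mu n.

Definition Lambda_ mu (n : nat) : R :=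
  ln (2 + mu) / ln (1 + mu) * (1 + 1 / ((1 + mu) * ln (1 + mu)))
  * (Kmu mu + 1)^-1 * T_ mu n.

End Defs.

(* Main.v *)
Require Import Defs.
From HB Require Import structures.
From mathcomp Require Import all_boot all_order all_algebra.
From mathcomp Require Import all_classical all_reals all_analysis.
From mathcomp Require Import measurable_realfun ring lra.
Import Order.TTheory GRing.Theory Num.Theory.
Import numFieldNormedType.Exports.
Local Open Scope classical_set_scope.
Local Open Scope ring_scope.

(* Put [m = n + 1] and let [K_y h] be the sum over k of
   [pnk n k y * m * \int_[k/m, (k+1)/m] h], a positive linear functional with
   [K_y 1 = 1], so that [LK f x = lnmu x * K_(a x) (fmu f)].
   Boundedness on L^p: Jensen's inequality gives [(K_y |h|)^p <= K_y (|h|^p)];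
   since [1 / a' <= Kmu] and [pnk n k] has integral [1 / m] over [0, 1], the
   substitution [y = a x] bounds the integral of [x |-> K_(a x) (|h|^p)] by [Kmu]
   times that of [|h|^p].
   Smooth functions: [fmu g] is Lipschitz with constant proportional to the C^1
   norm of [g].  For t in the k-th cell, [|t - x|] is at most
   [1/(2m) + |(k + 1/2)/m - a x| + gamma], and the variance of the Bernstein
   weights controls the mean of the middle term.
   For f and any C^1 function g, write
   [LK f - f = LK (f - g) + (LK g - g) + (g - f)] and take the infimum over g. *)

(** * Bernstein weights *)

(** Pascal's rule. The case k = n is separate because [n - k.+1] is then truncated; the zero
    binomial coefficient removes that term. *)
Lemma pnkSS (R : realType) (n k : nat) (y : R) : (k <= n)%N ->
  pnk n.+1 k.+1 y = y * pnk n k y + (1 - y) * pnk n k.+1 y.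
Proof.
move=> kn; rewrite /pnk binS natrD subSS exprS.
move: kn; rewrite leq_eqVlt => /predU1P[->|kn].
  by rewrite bin_small// subnn expr0; ring.
by rewrite -(subnSK kn) exprS; ring.
Qed.

Lemma pnk0S (R : realType) (n : nat) (y : R) :
  pnk n.+1 0 y = (1 - y) * pnk n 0 y.
Proof. by rewrite /pnk !bin0 !subn0 !expr0 exprS; ring. Qed.

Lemma pnk_gt (R : realType) (n k : nat) (y : R) : (n < k)%N -> pnk n k y = 0.
Proof. by move=> nk; rewrite /pnk bin_small// mulr0n !mul0r. Qed.

Lemma pnk_ge0 (R : realType) (n k : nat) (y : R) : 0 <= y <= 1 -> 0 <= pnk n k y.
Proof.
by move=> /andP[y0 y1]; rewrite /pnk !mulr_ge0 ?exprn_ge0 ?subr_ge0 ?ler0n.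
Qed.

(** Conditioning on the last of n + 1 Bernoulli trials: a success shifts the argument of [phi] by
    one. This recursion yields the moments of the weights by induction on n. *)
Lemma sum_pnkS (R : realType) (n : nat) (y : R) (phi : nat -> R) :
  \sum_(0 <= k < n.+2) pnk n.+1 k y * phi k =
  y * \sum_(0 <= k < n.+1) pnk n k y * phi k.+1 +
  (1 - y) * \sum_(0 <= k < n.+1) pnk n k y * phi k.
Proof.
rewrite big_nat_recl// pnk0S.
(* Splitting off k = 0 aligns the ranges; the term k = n + 1 added at the top has weight zero. *)
have -> : \sum_(0 <= k < n.+1) pnk n k y * phi k =
    pnk n 0 y * phi 0%N + \sum_(0 <= k < n.+1) pnk n k.+1 y * phi k.+1.
  by rewrite big_nat_recl// big_nat_recr//= (@pnk_gt _ n n.+1)// mul0r addr0.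
rewrite mulrDr addrCA; congr (_ + _); first by rewrite -mulrA.
rewrite !mulr_sumr -big_split/=; apply: eq_big_nat => k /andP[_ kn].
by rewrite pnkSS//; ring.
Qed.

Lemma sum_pnk (R : realType) (n : nat) (y : R) :
  \sum_(0 <= k < n.+1) pnk n k y = 1.
Proof.
transitivity (\sum_(0 <= k < n.+1) pnk n k y * 1).
  by apply: eq_bigr => k _; rewrite mulr1.
elim: n => [|n IH]; last by rewrite (sum_pnkS _ _ _ (fun=> 1)) IH; ring.
by rewrite big_nat1 /pnk bin0 !expr0; ring.
Qed.

(** Variance plus squared bias. The centre c is arbitrary because the induction step replaces c by c
    - 1 in the shifted sum. *)
Lemma sum_pnk_sqr (R : realType) (n : nat) (y c : R) :
  \sum_(0 <= k < n.+1) pnk n k y * (k%:R - c) ^+ 2 =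
  n%:R * y * (1 - y) + (n%:R * y - c) ^+ 2.
Proof.
elim: n c => [|n IH] c.
  by rewrite big_nat1 /pnk bin0 !expr0; ring.
rewrite (sum_pnkS _ _ _ (fun k => (k%:R - c) ^+ 2)) IH.
have -> : \sum_(0 <= k < n.+1) pnk n k y * (k.+1%:R - c) ^+ 2 =
    \sum_(0 <= k < n.+1) pnk n k y * (k%:R - (c - 1)) ^+ 2.
  by apply: eq_bigr => k _; congr (_ * _ ^+ 2); rewrite -natr1; ring.
by rewrite IH -natr1; ring.
Qed.

(* AM-GM in the form [2 s |z| <= 1 + s^2 z^2] with s = sqrt (n + 1). *)
Lemma sum_pnk_absdist (R : realType) (n : nat) (y : R) : 0 <= y <= 1 ->
  \sum_(0 <= k < n.+1) pnk n k y * `|(k%:R + 2^-1) / n.+1%:R - y| <=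
  Num.sqrt 2 / Num.sqrt n.+1%:R.
Proof.
move=> y01; have [y0 y1] := andP y01.
set m : R := n.+1%:R; set s := Num.sqrt m.
have m0 : 0 < m by rewrite ltr0n.
have s0 : 0 < s by rewrite sqrtr_gt0.
have sm : s ^+ 2 = m by rewrite sqr_sqrtr// ltW.
have amgm k : `|(k%:R + 2^-1) / m - y| <=
    2^-1 / s + (2^-1 / (s * m)) * (k%:R - (m * y - 2^-1)) ^+ 2.
  set z := _ - y.
  (* With the centre m y - 1/2, the second moment measures the distance from y to the cell midpoint
     (k + 1/2) / m. *)
  have -> : k%:R - (m * y - 2^-1) = m * z by rewrite /z; field; rewrite gt_eqF.
  rewrite exprMn -(real_normK (num_real z)).
  set a := `|z|.
  rewrite -subr_ge0.
  have -> : 2^-1 / s + 2^-1 / (s * m) * (m ^+ 2 * a ^+ 2) - a =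
      (2^-1 / s) * (1 - s * a) ^+ 2.
    by rewrite -sm; field; rewrite gt_eqF.
  by rewrite mulr_ge0 ?sqr_ge0// divr_ge0// ltW.
apply: (@le_trans _ _ (\sum_(0 <= k < n.+1) pnk n k y *
    (2^-1 / s + (2^-1 / (s * m)) * (k%:R - (m * y - 2^-1)) ^+ 2))).
  by apply: ler_sum => k _; apply: ler_wpM2l (amgm k); exact: pnk_ge0.
under eq_bigr do rewrite mulrDr (mulrCA (pnk _ _ _) (_ / (_ * _))).
rewrite big_split/= -mulr_suml -mulr_sumr sum_pnk mul1r sum_pnk_sqr.
have -> : n%:R = m - 1 by rewrite /m -natr1; ring.
have h2 : 1 <= Num.sqrt (2 : R) by rewrite -{1}sqrtr1 ler_sqrt ?ler1n.
(* The estimate gives 1 / s, half from each term; the factor sqrt 2 is slack. *)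
apply: (@le_trans _ _ (1 / s)); last by rewrite ler_pM2r ?invr_gt0.
(* The bias (m - 1) y - (m y - 1/2) equals 1/2 - y, with square at most 1/4, and the variance is at
   most m - 1. *)
have q : (m - 1) * y * (1 - y) + ((m - 1) * y - (m * y - 2^-1)) ^+ 2 <= m.
  have : (m - 1) * (y * (1 - y)) <= (m - 1) * 1.
    rewrite ler_wpM2l ?mulr_ile1 ?subr_ge0//; first by rewrite /m ler1n.
    by rewrite gerBl.
  have : y ^+ 2 <= y by rewrite expr2 ler_piMr.
  nra.
apply: (@le_trans _ _ (2^-1 / s + 2^-1 / (s * m) * m)).
  by rewrite lerD2l ler_wpM2l// divr_ge0// mulr_ge0 ?ltW.
by rewrite le_eqVlt; apply/orP; left; apply/eqP; field; rewrite !gt_eqF.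
Qed.

(** * The nodes [a_ mu n.+1 x] *)

Section nodes.
Variables (R : realType) (mu : R) (n : nat).
Hypothesis mu0 : 0 < mu.

Let b : R := n.+1%:R * (1 + mu).
Let D : R := ln (1 + 1 / b).

Let b0 : 0 < b. Proof. by rewrite mulr_gt0 ?ltr0n ?addr_gt0. Qed.

Let D0 : 0 < D. Proof. by rewrite ln_gt0// ltrDl divr_gt0. Qed.

Lemma a_0 : a_ mu n.+1 0 = 0.
Proof. by rewrite /a_ mul0r addr0 ln1 mul0r. Qed.

Lemma a_1 : a_ mu n.+1 1 = 1.
Proof. by rewrite /a_ divff// gt_eqF. Qed.

Lemma a_lt (x y : R) : 0 <= x -> x < y -> a_ mu n.+1 x < a_ mu n.+1 y.
Proof.
move=> x0 xy; have y0 : 0 < y by exact: le_lt_trans xy.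
rewrite /a_ ltr_pM2r ?invr_gt0// ltr_ln ?posrE.
- by rewrite ltrD2l ltr_pM2r ?invr_gt0.
- by rewrite ltr_wpDr// divr_ge0// ltW.
- by rewrite addr_gt0// divr_gt0.
Qed.

Lemma a_itv (x : R) : 0 <= x <= 1 -> 0 <= a_ mu n.+1 x <= 1.
Proof.
move=> /andP[]; rewrite le_eqVlt => /predU1P[<-|x0].
  by rewrite a_0 lexx ler01.
rewrite le_eqVlt => /predU1P[->|x1]; first by rewrite a_1 lexx ler01.
apply/andP; split; apply/ltW.
  by have := a_lt 0 x (lexx 0) x0; rewrite a_0.
by have := a_lt x 1 (ltW x0) x1; rewrite a_1.
Qed.

(** The condition 0 < x + b is open and covers [0, 1], so the formula also holds around the
    endpoints, where continuity of the derivative is needed. *)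
Lemma is_derive_a (x : R) : 0 < x + b ->
  is_derive x 1 (a_ mu n.+1) (((x + b) * D)^-1).
Proof.
move=> xb.
have h1 : is_derive x 1 (fun z : R => 1 + z / b) b^-1.
  have -> : (fun z : R => 1 + z / b) = cst 1 + b^-1 \*: (@id R).
    by apply/funext => z; rewrite !fctE /= mulrC.
  by apply: is_derive_eq; rewrite add0r scaler1.
have p0 : 0 < 1 + x / b.
  by rewrite -(divff (lt0r_neq0 b0)) -mulrDl divr_gt0// addrC.
have h2 := @is_derive1_comp R (@ln R) (fun z : R => 1 + z / b) x _ _
  (is_derive1_ln p0) h1.
have -> : a_ mu n.+1 = D^-1 \*: (@ln R \o (fun z : R => 1 + z / b)).
  by apply/funext => z; rewrite /a_ !fctE /= mulrC.
apply: is_derive_eq; rewrite /GRing.scale/=.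
by field; rewrite !gt_eqF.
Qed.

Lemma continuous_a (x : R) : 0 < x + b -> {for x, continuous (a_ mu n.+1)}.
Proof.
move=> /is_derive_a[+ _] => /derivable1_diffP.
exact: differentiable_continuous.
Qed.

Lemma cvg_derive_a (x : R) : 0 < x + b ->
  derive1 (a_ mu n.+1) y @[y --> x] --> ((x + b) * D)^-1.
Proof.
move=> xb; have xb' : - b < x by rewrite -subr_gt0 opprK.
apply: cvg_trans.
  apply: (near_eq_cvg (f := fun y => ((y + b) * D)^-1)).
  near=> y; rewrite derive1E; apply/esym/derive_val/is_derive_a.
  by rewrite -ltrBlDr sub0r; near: y; exact: lt_nbhsr.
apply: cvgV; first by rewrite mulf_neq0// gt_eqF.
apply: cvgM; last exact: cvg_cst.
by apply: cvgD; [exact: cvg_id|exact: cvg_cst].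
Unshelve. all: by end_near. Qed.

Lemma continuous_derive_a (x : R) : 0 < x + b ->
  {for x, continuous (derive1 (a_ mu n.+1))}.
Proof.
move=> xb; have := cvg_derive_a x xb.
by rewrite -(derive_val (is_derive := is_derive_a x xb)) -derive1E.
Qed.

End nodes.

(** * Integrals of the Bernstein weights *)

Lemma continuous_pnk (R : realType) (n k : nat) : continuous (@pnk R n k).
Proof.
move=> y; rewrite /pnk.
apply: cvgM; last by apply: continuous_onemXn.
by apply: cvgM; [exact: cvg_cst|exact: exprn_continuous].
Qed.

(** This is a Beta integral, with B(k + 1, n - k + 1) = k! (n - k)! / (n + 1)!. *)
Lemma integral_pnk (R : realType) (n k : nat) : (k <= n)%N ->
  (\int[@leb R]_(y in `[0%R, 1%R]) (pnk n k y)%:E)%E = (n.+1%:R^-1)%:E.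
Proof.
move=> kn.
have -> : (n.+1%:R^-1 : R) = 'C(n, k)%:R * beta_fun k.+1 (n - k).+1.
  rewrite beta_fun_fact subnKC// factS -(bin_fact kn) !natrM.
  have nz j : (0 < j)%N -> j%:R != 0 :> R by rewrite pnatr_eq0 -lt0n.
  have c0 : (0 < 'C(n, k))%N by rewrite bin_gt0.
  move: (nz _ c0) (nz _ (fact_gt0 k)) (nz _ (fact_gt0 (n - k))) (nz n.+1 isT).
  move: ('C(n, k)%:R) (k`!%:R) ((n - k)`!%:R) (n.+1%:R) => c f g m c_neq0 f0 g0 m0.
  by field; rewrite c_neq0 f0 g0.
rewrite EFinM EFin_beta_fun.
under eq_integral do rewrite /pnk -mulrA EFinM.
rewrite integralZl//; last exact: integrable_XMonemX.
congr (_ * _)%E; rewrite integral_mkcond; apply: eq_integral => x _.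
by rewrite /patch/=; case: ifP.
Qed.

Section integral_pnk_a.
Variables (R : realType) (mu : R) (n k : nat).
Hypotheses (mu0 : 0 < mu) (kn : (k <= n)%N).

(** Change of variables y = a x: the node map is increasing and fixes both endpoints of [0, 1]. *)
Lemma integral_pnk_a_derive :
  (\int[@leb R]_(x in `[0%R, 1%R])
    (pnk n k (a_ mu n.+1 x) * derive1 (a_ mu n.+1) x)%:E)%E = (n.+1%:R^-1)%:E.
Proof.
have b0 : 0 < n.+1%:R * (1 + mu) by rewrite mulr_gt0 ?ltr0n ?addr_gt0.
have xb x : 0 <= x -> 0 < x + n.+1%:R * (1 + mu) by move=> x0; rewrite ltr_wpDl.
rewrite -(integral_pnk R n k kn).
rewrite /leb.
have := @integration_by_substitution_increasing R (a_ mu n.+1) (@pnk R n k) 0 1.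
rewrite a_0 a_1// => ->//.
- by move=> x y; rewrite !in_itv/= => /andP[x0 _] _; exact: a_lt.
- move=> x; rewrite in_itv/= => /andP[x0 _].
  exact: (continuous_derive_a R mu n mu0 x (xb x (ltW x0))).
- apply: cvgP; apply: cvg_at_right_filter; apply: cvg_derive_a => //.
  exact: xb.
- apply: cvgP; apply: cvg_at_left_filter; apply: cvg_derive_a => //.
  exact: xb.
- split.
  + move=> x; rewrite in_itv/= => /andP[x0 _].
    by have [] := is_derive_a R mu n mu0 x (xb x (ltW x0)).
  + by apply: cvg_at_right_filter; apply: continuous_a => //; exact: xb.
  + by apply: cvg_at_left_filter; apply: continuous_a => //; exact: xb.
- by apply: continuous_subspaceT; exact: continuous_pnk.
Qed.

Lemma measurable_pnk_a : measurable_fun (`[0, 1] : set R) (fun x : R => pnk n k (a_ mu n.+1 x)).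
Proof.
apply: subspace_continuous_measurable_fun => //.
apply: continuous_in_subspaceT => x; rewrite inE/= in_itv/= => /andP[x0 _].
apply: continuous_comp; last exact: continuous_pnk.
by apply: continuous_a => //; rewrite ltr_wpDl// mulr_gt0 ?addr_gt0.
Qed.

Lemma derive_a_ge (x : R) : 0 <= x <= 1 -> (Kmu mu)^-1 <= derive1 (a_ mu n.+1) x.
Proof.
move=> /andP[x0 x1].
set m : R := n.+1%:R.
have m1 : 1 <= m by rewrite ler1n.
have m0 : 0 < m by exact: lt_le_trans m1.
have mu1 : 0 < 1 + mu by rewrite addr_gt0.
have b0 : 0 < m * (1 + mu) by rewrite mulr_gt0.
have xb : 0 < x + m * (1 + mu) by rewrite ltr_wpDl.
rewrite derive1E (derive_val (is_derive := is_derive_a R mu n mu0 x xb)) -/m.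
set b := m * (1 + mu) in b0 xb *.
have D0 : 0 < ln (1 + 1 / b) by rewrite ln_gt0// ltrDl divr_gt0.
rewrite lef_pV2 ?posrE; last 2 first.
- by rewrite /Kmu addr_gt0// divr_gt0.
- by rewrite mulr_gt0.
(* From x <= 1 and ln (1 + u) <= u at u = 1 / b, the reciprocal of the derivative is at most 1 + 1 /
   b; then b >= 1 + mu gives [Kmu mu]. *)
apply: (@le_trans _ _ ((1 + b) * (1 / b))).
  apply: ler_pM; [exact: ltW|exact: ltW|by rewrite lerD2r|].
  by apply: le_ln1Dx; rewrite (@lt_trans _ _ 0) ?ltrN10// divr_gt0.
have -> : (1 + b) * (1 / b) = 1 + 1 / b by field; rewrite gt_eqF.
rewrite /Kmu lerD2l ler_pM2l// lef_pV2 ?posrE// /b.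
by rewrite ler_peMl// ltW.
Qed.

(** Since [Kmu mu] times the derivative of the node map is at least 1, inserting it under the
    integral only increases the integrand, and the substitution formula applies. *)
Lemma integral_pnk_a_le :
  (\int[@leb R]_(x in `[0%R, 1%R]) (pnk n k (a_ mu n.+1 x))%:E <=
   (Kmu mu / n.+1%:R)%:E)%E.
Proof.
have K0 : 0 < Kmu mu by rewrite /Kmu addr_gt0// divr_gt0// addr_gt0.
have md : measurable_fun (`[0, 1] : set R) (fun x : R =>
    pnk n k (a_ mu n.+1 x) * derive1 (a_ mu n.+1) x).
  apply: measurable_funM; first exact: measurable_pnk_a.
  apply: subspace_continuous_measurable_fun => //.
  apply: continuous_in_subspaceT => x; rewrite inE/= in_itv/= => /andP[x0 _].
  have xb : 0 < x + n.+1%:R * (1 + mu) by rewrite ltr_wpDl// mulr_gt0 ?addr_gt0.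
  exact: (continuous_derive_a R mu n mu0 x xb).
have d0 x : 0 <= x <= 1 -> 0 <= derive1 (a_ mu n.+1) x.
  by move=> x01; rewrite (le_trans _ (derive_a_ge x x01))// invr_ge0 ltW.
rewrite EFinM -integral_pnk_a_derive -ge0_integralZl_EFin//; last 3 first.
- move=> x; rewrite /= in_itv/= => x01.
  by rewrite lee_fin mulr_ge0 ?d0// pnk_ge0// a_itv.
- exact/measurable_EFinP.
- exact: ltW.
apply: ge0_le_integral => //.
- by move=> x; rewrite /= in_itv/= => x01; rewrite lee_fin pnk_ge0// a_itv.
- by apply/measurable_EFinP; exact: measurable_pnk_a.
- by apply: measurable_funeM; apply/measurable_EFinP.
move=> x; rewrite /= in_itv/= => x01.
rewrite -EFinM lee_fin mulrCA ler_peMr ?pnk_ge0 ?a_itv//.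
by rewrite -ler_pdivrMl// mulr1 derive_a_ge.
Qed.

End integral_pnk_a.

(** * The averaging functional *)

(** [integ] goes through [fine], which sends infinite integrals to 0, so linearity and monotonicity
    of the cell averages are stated for integrable functions. *)
Definition int01 (R : realType) (h : R -> R) :=
  (@leb R).-integrable (`[0, 1] : set R) (EFin \o h).

Section kantorovich.
Variable R : realType.
Implicit Types (h u v : R -> R) (n k : nat) (y c : R).


(* [LK mu n f x] is [lnmu mu x * Kant n (a_ mu n.+1 x) (fmu mu f)] by conversion. *)
Definition Kant n y h : R := \sum_(0 <= k < n.+1)
  pnk n k y * n.+1%:R * integ (k%:R / n.+1%:R) (k.+1%:R / n.+1%:R) h.

Let cell n k : set R := `[k%:R / n.+1%:R, k.+1%:R / n.+1%:R].

Lemma cell_sub n k : (k <= n)%N -> cell n k `<=` `[0, 1].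
Proof.
move=> kn t; rewrite /cell /= !in_itv/= => /andP[t0 t1]; apply/andP; split.
  by rewrite (le_trans _ t0)// divr_ge0.
by rewrite (le_trans t1)// ler_pdivrMr ?ltr0n// mul1r ler_nat.
Qed.

Lemma integrable_cell n k h : (k <= n)%N -> int01 R h ->
  (@leb R).-integrable (cell n k) (EFin \o h).
Proof.
move=> kn; apply: integrableS.
- exact: measurable_itv.
- exact: measurable_itv.
- exact: cell_sub.
Qed.

Lemma fine_leb_cell n k : n.+1%:R * fine (leb (cell n k)) = 1 :> R.
Proof.
rewrite /leb /cell lebesgue_measure_itv/= lte_fin ltr_pM2r ?invr_gt0 ?ltr0n//.
rewrite ltr_nat ltnSn /= -mulrBl -natrB ?leqnSn// subSnn mul1r.
by rewrite divff// pnatr_eq0.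
Qed.

Lemma integ_cst n k c : n.+1%:R * integ (k%:R / n.+1%:R) (k.+1%:R / n.+1%:R) (fun=> c) = c.
Proof.
rewrite -[integ _ _ _]/(Rintegral _ _ _) Rintegral_cst// mulrCA.
by rewrite (fine_leb_cell n k) mulr1.
Qed.

Lemma Kant_cst n y c : Kant n y (fun=> c) = c.
Proof.
rewrite /Kant; under eq_bigr do rewrite -mulrA integ_cst.
by rewrite -mulr_suml sum_pnk mul1r.
Qed.

Lemma KantD n y u v : int01 R u -> int01 R v ->
  Kant n y (fun t => u t + v t) = Kant n y u + Kant n y v.
Proof.
move=> iu iv; rewrite /Kant -big_split; apply: eq_big_nat => k /andP[_ kn].
rewrite /= -mulrDr; congr (_ * _).
by apply: RintegralD => //; exact: integrable_cell.
Qed.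

Lemma KantZ n y c u : int01 R u -> Kant n y (fun t => c * u t) = c * Kant n y u.
Proof.
move=> iu; rewrite /Kant mulr_sumr; apply: eq_big_nat => k /andP[_ kn].
rewrite mulrCA; congr (_ * _).
by apply: RintegralZl => //; exact: integrable_cell.
Qed.

Lemma le_Kant n y u v : 0 <= y <= 1 -> int01 R u -> int01 R v ->
  (forall t, 0 <= t <= 1 -> u t <= v t) -> Kant n y u <= Kant n y v.
Proof.
move=> y01 iu iv uv; apply: ler_sum_nat => k /andP[_ kn].
apply: ler_wpM2l; first by rewrite mulr_ge0// pnk_ge0.
apply: le_Rintegral => //; [exact: integrable_cell..|].
by move=> t /(@cell_sub n k kn); rewrite /= in_itv/= => /uv.
Qed.

(** Constants are reproduced, so only the deviation from c on each cell matters. The bound [d]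
    depends on the cell alone, which leaves a Bernstein sum to estimate. *)
Lemma Kant_near n y u c (d : nat -> R) : 0 <= y <= 1 -> int01 R u ->
  (forall k t, (k <= n)%N -> t \in `[(k%:R / n.+1%:R : R), k.+1%:R / n.+1%:R] ->
    `|u t - c| <= d k) ->
  `|Kant n y u - c| <= \sum_(0 <= k < n.+1) pnk n k y * d k.
Proof.
move=> y01 iu ud; rewrite -[X in `|_ - X|](Kant_cst n y).
rewrite /Kant -sumrB (le_trans (ler_norm_sum _ _ _))//.
apply: ler_sum_nat => k /andP[_ kn].
rewrite -mulrBr -mulrA normrM ger0_norm ?pnk_ge0//.
apply: ler_wpM2l; first exact: pnk_ge0.
have ic r : (@leb R).-integrable (cell n k) (EFin \o cst r).
  apply: continuous_compact_integrable; first exact: segment_compact.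
  by move=> ?; exact: cvg_cst.
have iuk := integrable_cell n k u kn iu.
have mc : measurable (cell n k : set (measurableTypeR R)) by exact: measurable_itv.
have iuc : (@leb R).-integrable (cell n k) (EFin \o (fun t => u t - c)).
  have := integrableB mc iuk (ic c).
  by apply: eq_integrable => // t _; rewrite /= EFinB.
rewrite -[leRHS](integ_cst n k) normrM ger0_norm//.
apply: ler_wpM2l => //.
rewrite -(RintegralB (mu := @leb R) (D := cell n k))//; last exact: (ic c).
apply: (le_trans (le_normr_Rintegral mc iuc)).
apply: le_Rintegral => //; [|exact: (ic (d k))|by move=> t; exact: ud].
exact: (integrable_norm iuc).
Qed.

Lemma sum_integ n u : int01 R u ->
  \sum_(0 <= k < n.+1) integ (k%:R / n.+1%:R) (k.+1%:R / n.+1%:R) u = integ 0 1 u.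
Proof.
move=> iu.
have n0 : 0 < n.+1%:R :> R by rewrite ltr0n.
(* For the induction, the claim is generalised to [0, j / m], the union of the first j cells. *)
suff H j : (j <= n.+1)%N ->
    \sum_(0 <= k < j) integ (k%:R / n.+1%:R) (k.+1%:R / n.+1%:R) u =
    integ 0 (j%:R / n.+1%:R) u.
  by rewrite H// divff// gt_eqF.
elim: j => [_|j IH jn].
  by rewrite big_geq// mul0r /integ set_itv1 integral_set1.
rewrite big_nat_recr//= IH ?(ltnW jn)//.
apply/eqP; rewrite eq_sym addrC -subr_eq; apply/eqP.
have jm : j.+1%:R / n.+1%:R <= 1 :> R.
  by rewrite ler_pdivrMr// mul1r ler_nat.
have i1 : (@leb R).-integrable `[0, j.+1%:R / n.+1%:R] (EFin \o u).
  apply: integrableS iu => // t; rewrite /= !in_itv/= => /andP[-> tj].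
  exact: le_trans jm.
rewrite -[LHS]/(Rintegral _ _ _ - Rintegral _ _ _) Rintegral_itvB//; last 2 first.
- by rewrite bnd_simp divr_ge0.
- by rewrite bnd_simp ler_pM2r ?invr_gt0// ler_nat.
(* The difference of the two integrals lives on a half-open cell; its missing left endpoint is a
   null set. *)
rewrite Rintegral_itv_obnd_cbnd//.
apply: integrableS iu => // t; rewrite /= !in_itv/= => /andP[jt tj].
apply/andP; split; first by rewrite (le_trans _ (ltW jt))// divr_ge0.
exact: le_trans jm.
Qed.
End kantorovich.

(* Young's inequality for the exponents p and p / (p - 1). *)
Lemma powR_tangent (R : realType) (p c s : R) : 1 <= p -> 0 <= c -> 0 <= s ->
  p * c `^ (p - 1) * s - (p - 1) * c `^ p <= s `^ p.
Proof.
(* The exponent p = 1 has no finite conjugate and is checked directly. *)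
rewrite le_eqVlt => /predU1P[<- c0 s0|p1 c0 s0].
  by rewrite subrr powRr0 !powRr1// mul0r subr0 mulr1 mul1r.
have p0 : 0 < p by exact: lt_trans p1.
have q0 : 0 < p - 1 by rewrite subr_gt0.
have pq : p^-1 + (p / (p - 1))^-1 = 1 by field; rewrite !gt_eqF.
(* Young's inequality is applied to s and c^(p - 1); the conjugate power of the latter is c^p. *)
have := @conjugate_powR R s (c `^ (p - 1)) p (p / (p - 1)) s0 (powR_ge0 _ _) p0
  (divr_gt0 p0 q0) pq.
rewrite -powRrM mulrCA divff ?gt_eqF// mulr1 => H.
have -> : s `^ p = p * (s `^ p / p) by rewrite mulrCA divff ?gt_eqF// mulr1.
rewrite lerBlDr -mulrA.
apply: (le_trans (ler_wpM2l (ltW p0) _)) => [|].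
  by rewrite mulrC; exact: H.
rewrite mulrDr lerD2l le_eqVlt; apply/orP; left; apply/eqP.
by field; rewrite !gt_eqF.
Qed.

(** * Jensen's inequality and integration of the averages *)

Section kantorovich_Lp.
Variable R : realType.
Implicit Types (h u v : R -> R) (n k : nat) (y c p : R).

Lemma measurable01 : measurable (`[0, 1] : set (measurableTypeR R)).
Proof. exact: measurable_itv. Qed.

Lemma int01_cst c : int01 R (fun=> c).
Proof.
apply: continuous_compact_integrable; first exact: segment_compact.
by move=> ?; exact: cvg_cst.
Qed.

Lemma int01Z c u : int01 R u -> int01 R (fun t => c * u t).
Proof.
move=> iu; have := integrableZl measurable01 c iu.
by apply: eq_integrable => // t _; rewrite /= EFinM.
Qed.

Lemma int01D u v : int01 R u -> int01 R v -> int01 R (fun t => u t + v t).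
Proof.
move=> iu iv; have := integrableD measurable01 iu iv.
by apply: eq_integrable => // t _; rewrite /= EFinD.
Qed.

Lemma Kant_ge0 n y u : 0 <= y <= 1 -> int01 R u ->
  (forall t, 0 <= t <= 1 -> 0 <= u t) -> 0 <= Kant R n y u.
Proof.
move=> y01 iu u0; rewrite -(Kant_cst R n y 0); apply: le_Kant => //.
exact: int01_cst.
Qed.

Lemma le_norm_Kant n y u : 0 <= y <= 1 -> int01 R u ->
  `|Kant R n y u| <= Kant R n y (fun t => `|u t|).
Proof.
move=> y01 iu.
have iabs : int01 R (fun t => `|u t|) by exact: (integrable_norm iu).
rewrite ler_norml; apply/andP; split; last first.
  by apply: le_Kant => // t _; exact: ler_norm.
rewrite -mulN1r -KantZ//; apply: le_Kant => //; first exact: int01Z.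
by move=> t _; rewrite mulN1r lerNl -normrN ler_norm.
Qed.

(* Jensen's inequality, from the tangent of [s `^ p] at [c]. *)
Lemma Kant_powR n y u p : 1 <= p -> 0 <= y <= 1 ->
  int01 R u -> int01 R (fun t => u t `^ p) -> (forall t, 0 <= u t) ->
  Kant R n y u `^ p <= Kant R n y (fun t => u t `^ p).
Proof.
move=> p1 y01 iu iup u0; set c := Kant R n y u.
have c0 : 0 <= c by exact: Kant_ge0.
have ilin : int01 R (fun t => p * c `^ (p - 1) * u t) by exact: int01Z.
(* As c is the average of u, the tangent line at c averages to p c^(p - 1) c - (p - 1) c^p = c^p. *)
have -> : c `^ p = Kant R n y
    (fun t => p * c `^ (p - 1) * u t + - ((p - 1) * c `^ p)).
  rewrite KantD//; last exact: int01_cst.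
  rewrite KantZ// Kant_cst.
  rewrite -/c -mulrA (mulrC _ c) mulr_powRB1//; last exact: lt_le_trans p1.
  by ring.
apply: le_Kant => //; first by apply: int01D => //; exact: int01_cst.
by move=> t _; exact: powR_tangent.
Qed.

(** Each weight integrates to at most [Kmu mu] / m, which cancels the factor m before the cell
    integrals; these add up to the integral over [0, 1]. *)
Lemma integral_Kant_a mu n u : 0 < mu -> int01 R u -> (forall t, 0 <= u t) ->
  (\int[@leb R]_(x in `[0%R, 1%R]) (Kant R n (a_ mu n.+1 x) u)%:E <=
   (Kmu mu)%:E * \int[@leb R]_(x in `[0%R, 1%R]) (u x)%:E)%E.
Proof.
move=> mu0 iu u0.
set w := fun k => n.+1%:R * integ (k%:R / n.+1%:R) (k.+1%:R / n.+1%:R) u.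
have w0 k : 0 <= w k.
  by rewrite mulr_ge0// fine_ge0// integral_ge0// => t _; rewrite lee_fin.
have mp k : measurable_fun (`[0, 1] : set R) (fun x => pnk n k (a_ mu n.+1 x)).
  exact: measurable_pnk_a.
have p0 k x : `[0, 1]%classic x -> (0 <= (pnk n k (a_ mu n.+1 x))%:E)%E.
  by rewrite /= in_itv/= => x01; rewrite lee_fin pnk_ge0// a_itv.
have -> : (\int[@leb R]_(x in `[0%R, 1%R]) (Kant R n (a_ mu n.+1 x) u)%:E =
    \int[@leb R]_(x in `[0%R, 1%R])
      \sum_(0 <= k < n.+1) (w k)%:E * (pnk n k (a_ mu n.+1 x))%:E)%E.
  apply: eq_integral => x _; rewrite /Kant -sumEFin; apply: eq_bigr => k _.
  by rewrite -EFinM /w -mulrA mulrC.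
rewrite ge0_integral_sum//; last 2 first.
- move=> k; apply: measurable_funeM; apply/measurable_EFinP; exact: mp.
- by move=> k x x01; apply: mule_ge0; [rewrite lee_fin|exact: p0].
apply: (@le_trans _ _ (\sum_(0 <= k < n.+1)
    (w k)%:E * (Kmu mu / n.+1%:R)%:E)%E).
  rewrite big_nat_cond [leRHS]big_nat_cond; apply: lee_sum => k.
  rewrite andbT => /andP[_ kn].
  rewrite ge0_integralZl_EFin//; last 2 first.
  - by move=> x; exact: p0.
  - by apply/measurable_EFinP; exact: mp.
  by apply: lee_wpmul2l; rewrite ?lee_fin// integral_pnk_a_le.
under eq_bigr do rewrite -EFinM.
rewrite sumEFin -mulr_suml -mulr_sumr sum_integ//.
rewrite le_eqVlt; apply/orP; left; apply/eqP.
have -> : n.+1%:R * integ 0 1 u * (Kmu mu / n.+1%:R) = Kmu mu * integ 0 1 u.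
  by field; rewrite addrC natr1 pnatr_eq0.
rewrite EFinM; congr (_ * _)%E; rewrite /integ fineK//.
exact: (integrable_fin_num measurable01 iu).
Qed.
End kantorovich_Lp.

(** * The operator on L^p *)

Section lnmu.
Variables (R : realType) (mu : R).
Hypothesis mu0 : 0 < mu.

Lemma ln1mu_gt0 : 0 < ln (1 + mu).
Proof. by rewrite ln_gt0// ltrDl. Qed.

Lemma lnmu_ge (x : R) : 0 <= x -> ln (1 + mu) <= lnmu mu x.
Proof.
move=> x0; have mu1 : 0 < 1 + mu by rewrite addr_gt0.
by rewrite /lnmu ler_ln ?posrE ?lerDl// ltr_wpDr.
Qed.

Lemma lnmu_gt0 (x : R) : 0 <= x -> 0 < lnmu mu x.
Proof. by move=> /lnmu_ge; apply: lt_le_trans; exact: ln1mu_gt0. Qed.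

Lemma lnmu_le (x : R) : 0 <= x <= 1 -> lnmu mu x <= ln (2 + mu).
Proof.
move=> /andP[x0 x1]; have mu1 : 0 < 1 + mu by rewrite addr_gt0.
rewrite /lnmu ler_ln ?posrE; first by lra.
  by rewrite ltr_wpDr.
by rewrite addr_gt0.
Qed.

Lemma is_derive_lnmu (x : R) : 0 <= x ->
  is_derive x 1 (lnmu mu) (1 + mu + x)^-1.
Proof.
move=> x0; have p0 : 0 < 1 + mu + x by rewrite ltr_wpDr// addr_gt0.
have h1 : is_derive x 1 (fun z : R => 1 + mu + z) 1.
  have -> : (fun z : R => 1 + mu + z) = cst (1 + mu) + @id R by [].
  by apply: is_derive_eq; rewrite add0r.
have := @is_derive1_comp R (@ln R) (fun z : R => 1 + mu + z) x _ _
  (is_derive1_ln p0) h1.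
by rewrite mulr1.
Qed.

Lemma continuous_lnmu (x : R) : 0 <= x -> {for x, continuous (lnmu mu)}.
Proof.
move=> /is_derive_lnmu[+ _] => /derivable1_diffP.
exact: differentiable_continuous.
Qed.

Lemma measurable_lnmu : measurable_fun (`[0, 1] : set R) (lnmu mu).
Proof.
apply: subspace_continuous_measurable_fun => //.
apply: continuous_in_subspaceT => x; rewrite inE/= in_itv/= => /andP[x0 _].
exact: continuous_lnmu.
Qed.

Lemma measurable_lnmuV : measurable_fun (`[0, 1] : set R) (fun x => (lnmu mu x)^-1).
Proof.
apply: subspace_continuous_measurable_fun => //.
apply: continuous_in_subspaceT => x; rewrite inE/= in_itv/= => /andP[x0 _].
apply: cvgV; first by rewrite gt_eqF// lnmu_gt0.
exact: continuous_lnmu.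
Qed.

Lemma normr_fmu_le (h : R -> R) (x : R) : 0 <= x ->
  `|fmu mu h x| <= (ln (1 + mu))^-1 * `|h x|.
Proof.
move=> x0; rewrite /fmu normrM mulrC ler_wpM2r// normfV.
rewrite (gtr0_norm (lnmu_gt0 x x0)) lef_pV2 ?posrE ?lnmu_ge ?lnmu_gt0//.
exact: ln1mu_gt0.
Qed.

Lemma int01_fmu (h : R -> R) : int01 R h -> int01 R (fmu mu h).
Proof.
move=> ih.
have ih' := int01Z R (ln (1 + mu))^-1 _ (integrable_norm ih).
apply: (le_integrable (measurable01 R) _ _ ih').
  apply/measurable_EFinP; apply: measurable_funM; last exact: measurable_lnmuV.
  by apply/measurable_EFinP; exact: (measurable_int _ ih).
move=> x; rewrite /= in_itv/= => /andP[x0 _]; rewrite lee_fin.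
rewrite [leRHS]ger0_norm ?normr_fmu_le// mulr_ge0// invr_ge0 ltW//.
exact: ln1mu_gt0.
Qed.

Lemma measurable_LK (n : nat) (h : R -> R) :
  measurable_fun (`[0, 1] : set R) (LK mu n h).
Proof.
apply: measurable_funM; first exact: measurable_lnmu.
apply: measurable_sum => k; apply: measurable_funM => //.
by apply: measurable_funM => //; exact: measurable_pnk_a.
Qed.

(** The constant is an upper bound of [lnmu] over a lower bound: the outer factor is at most ln (2 +
    mu), and the division inside [fmu] costs at most 1 / ln (1 + mu). *)
Lemma normr_LK_le (n : nat) (h : R -> R) (x : R) : int01 R h -> 0 <= x <= 1 ->
  `|LK mu n h x| <=
  ln (2 + mu) / ln (1 + mu) * Kant R n (a_ mu n.+1 x) (fun t => `|h t|).
Proof.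
move=> ih x01; have [x0 x1] := andP x01.
have iabs : int01 R (fun t => `|h t|) by exact: (integrable_norm ih).
have iabs' : int01 R (fun t => `|fmu mu h t|).
  exact: (integrable_norm (int01_fmu h ih)).
have a01 := a_itv R mu n mu0 x x01.
rewrite -[LK _ _ _ _]/(lnmu mu x * Kant R n (a_ mu n.+1 x) (fmu mu h)) normrM.
rewrite (gtr0_norm (lnmu_gt0 x x0)) -mulrA -KantZ//.
apply: ler_pM => //; first exact/ltW/lnmu_gt0.
  exact: lnmu_le.
apply: (le_trans (le_norm_Kant R n _ _ a01 (int01_fmu h ih))).
apply: le_Kant => //; first exact: int01Z.
by move=> t /andP[t0 _]; exact: normr_fmu_le.
Qed.

End lnmu.

(** * The L^p norm on [0, 1] *)

Section Lpnorm.
Variables (R : realType) (p : R).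
Hypothesis p1 : 1 <= p.
Implicit Types (u v : R -> R).

Let p0 : 0 < p. Proof. exact: lt_le_trans p1. Qed.

Lemma LpnormE u : Lpnorm p u =
  ((\int[@leb R]_(x in `[0%R, 1%R]) (`|u x| `^ p)%:E) `^ p^-1)%E.
Proof.
by rewrite /Lpnorm; congr (_ `^ _)%E; apply: eq_integral => x _; rewrite poweR_EFin.
Qed.

(** Extension by zero identifies the norm on [0, 1] with the library norm on the whole line, for
    which Minkowski's inequality is available. *)
Lemma Lpnorm_Lnorm u :
  Lpnorm p u = ('N[@leb R]_p%:E[EFin \o (u \_ `[0%R, 1%R])%R])%E.
Proof.
rewrite unlock LpnormE [in LHS]integral_mkcond; congr (_ `^ _)%E.
apply: eq_integral => x _; rewrite /= /patch; case: ifP => //= _.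
by rewrite normr0 powR0// gt_eqF.
Qed.

Lemma LpnormD u v : measurable_fun (`[0, 1] : set R) u ->
  measurable_fun (`[0, 1] : set R) v ->
  (Lpnorm p (fun x => u x + v x)%R <= Lpnorm p u + Lpnorm p v)%E.
Proof.
move=> mu mv; rewrite !Lpnorm_Lnorm.
have -> : (fun x => u x + v x) \_ `[0, 1] = (u \_ `[0, 1] \+ v \_ `[0, 1]).
  by apply/funext => x; rewrite /patch/=; case: ifP; rewrite ?addr0.
apply: minkowski_EFin => //.
- by apply/(measurable_restrictT _ _).1 => //; exact: measurable01.
- by apply/(measurable_restrictT _ _).1 => //; exact: measurable01.
Qed.

Lemma measurable_normr_powR u : measurable_fun (`[0, 1] : set R) u ->
  measurable_fun (`[0, 1] : set R) (fun x => `|u x| `^ p).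
Proof.
move=> mu; apply: (measurableT_comp (measurable_powR p)).
exact: measurableT_comp.
Qed.

(** The interval has measure 1, so a uniform bound passes to the L^p norm unchanged. *)
Lemma Lpnorm_le_cst u (B : R) : measurable_fun (`[0, 1] : set R) u -> 0 <= B ->
  (forall x, 0 <= x <= 1 -> `|u x| <= B) -> (Lpnorm p u <= B%:E)%E.
Proof.
move=> mu B0 uB; rewrite LpnormE.
rewrite -[leRHS](_ : ((B `^ p)%:E `^ p^-1 = _)%E); last first.
  by rewrite poweR_EFin -powRrM divff ?gt_eqF// powRr1.
apply: gt0_ler_poweR; rewrite ?invr_ge0 ?(ltW p0)//.
- by rewrite in_itv/= leey andbT integral_ge0// => x _; rewrite lee_fin powR_ge0.
- by rewrite in_itv/= leey andbT lee_fin powR_ge0.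
apply: (@le_trans _ _ (\int[@leb R]_(x in `[0%R, 1%R]) (B `^ p)%:E)%E).
  apply: ge0_le_integral => //.
  - by apply/measurable_EFinP; exact: measurable_normr_powR.
  move=> x; rewrite /= in_itv/= => x01; rewrite lee_fin.
  by apply: ge0_ler_powR; rewrite ?nnegrE ?(ltW p0)//; exact: uB.
by rewrite integral_cst//= /leb lebesgue_measure_itv/= lte01 EFinN sube0 mule1.
Qed.

End Lpnorm.

(** The pointwise bound is raised to the power p, Jensen's inequality moves the power inside the
    average, and integration over x costs [Kmu mu]; a p-th root concludes. *)
Lemma Lpnorm_LK (R : realType) (mu p : R) (n : nat) (h : R -> R) :
  0 < mu -> 1 <= p -> int01 R h -> int01 R (fun x => `|h x| `^ p) ->
  (Lpnorm p (LK mu n h) <=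
   (ln (2 + mu) / ln (1 + mu) * Kmu mu)%:E * Lpnorm p h)%E.
Proof.
move=> mu0 p1 ih ihp.
have p0 : 0 < p by exact: lt_le_trans p1.
have iabs : int01 R (fun t => `|h t|) by exact: (integrable_norm ih).
set rho := ln (2 + mu) / ln (1 + mu).
have rho0 : 0 <= rho by rewrite divr_ge0// ln_ge0//; lra.
have K1 : 1 <= Kmu mu by rewrite /Kmu lerDl divr_ge0//; lra.
have K0 : 0 <= Kmu mu by exact: le_trans K1.
set A := (\int[@leb R]_(x in `[0%R, 1%R]) (`|h x| `^ p)%:E)%E.
have A0 : (0 <= A)%E by apply: integral_ge0 => x _; rewrite lee_fin powR_ge0.
have mK : measurable_fun (`[0, 1] : set R)
    (fun x => Kant R n (a_ mu n.+1 x) (fun t => `|h t| `^ p)).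
  apply: measurable_sum => k; apply: measurable_funM => //.
  by apply: measurable_funM => //; exact: measurable_pnk_a.
have K_ge0 x : 0 <= x <= 1 -> 0 <= Kant R n (a_ mu n.+1 x) (fun t => `|h t| `^ p).
  by move=> x01; apply: Kant_ge0 => //; exact: a_itv.
have LKint : (\int[@leb R]_(x in `[0%R, 1%R]) (`|LK mu n h x| `^ p)%:E <=
    (rho `^ p * Kmu mu)%:E * A)%E.
  rewrite EFinM -muleA.
  apply: (@le_trans _ _ ((rho `^ p)%:E * \int[@leb R]_(x in `[0%R, 1%R])
     (Kant R n (a_ mu n.+1 x) (fun t => `|h t| `^ p))%:E)%E); last first.
    apply: lee_wpmul2l; first by rewrite lee_fin powR_ge0.
    by apply: integral_Kant_a => // t; exact: powR_ge0.
  rewrite -ge0_integralZl_EFin//; last 2 first.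
  - exact/measurable_EFinP.
  - exact: powR_ge0.
  apply: ge0_le_integral => //.
  - apply/measurable_EFinP; apply: measurable_normr_powR.
    exact: measurable_LK.
  - by apply: measurable_funeM; apply/measurable_EFinP.
  move=> x; rewrite /= in_itv/= => x01; rewrite -EFinM lee_fin.
  have a01 := a_itv R mu n mu0 x x01.
  apply: (@le_trans _ _
      ((rho * Kant R n (a_ mu n.+1 x) (fun t => `|h t|)) `^ p)).
    apply: ge0_ler_powR; rewrite ?nnegrE ?(ltW p0)//.
      by rewrite mulr_ge0// Kant_ge0.
    exact: normr_LK_le.
  rewrite powRM//; last by rewrite Kant_ge0.
  by apply: ler_wpM2l; [exact: powR_ge0|exact: Kant_powR].
rewrite !LpnormE// -/A.
apply: (@le_trans _ _ (((rho `^ p * Kmu mu)%:E * A) `^ p^-1)%E).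
  apply: gt0_ler_poweR => //; rewrite ?invr_ge0 ?(ltW p0)//.
  - by rewrite in_itv/= leey andbT integral_ge0// => x _; rewrite lee_fin powR_ge0.
  - by rewrite in_itv/= leey andbT mule_ge0// lee_fin mulr_ge0// powR_ge0.
rewrite poweRM//; last by rewrite lee_fin mulr_ge0// powR_ge0.
apply: lee_wpmul2r; first exact: poweR_ge0.
rewrite poweR_EFin lee_fin powRM ?powR_ge0// -powRrM divff ?gt_eqF// powRr1//.
apply: ler_wpM2l => //.
(* The root leaves [Kmu mu] to the power 1 / p, at most [Kmu mu] because [Kmu mu] >= 1. *)
by apply: ler1_powR => //; rewrite invf_le1.
Qed.

(** * The operator on C^1 functions and conclusion *)

(** [sup] dominates a set only when the set is bounded above; the extreme value theorem supplies the
    bound. *)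
Lemma le_supnorm01 (R : realType) (u : R -> R) (x : R) :
  {within `[0, 1], continuous u} -> 0 <= x <= 1 -> `|u x| <= supnorm01 u.
Proof.
move=> cu x01.
have cnu : {within `[0, 1], continuous (fun z => `|u z|)}.
  by move=> z; apply: (@cvg_norm _ _ _ _ (nbhs_filter z)); exact: cu.
have [c c01 uc] := EVT_max ler01 cnu.
apply: (ub_le_sup _ _); last by exists x; rewrite //= in_itv.
by exists `|u c| => _ [z z01 <-]; exact: uc.
Qed.

(** Both a x and x lie in [0, 1], so 1 bounds the set whose [sup] is taken. *)
Lemma le_gamma_ (R : realType) (mu : R) (n : nat) (x : R) : 0 < mu ->
  0 <= x <= 1 -> `|a_ mu n.+1 x - x| <= gamma_ mu n.
Proof.
move=> mu0 x01; apply: (ub_le_sup _ _); last by exists x; rewrite //= in_itv.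
exists 1 => _ [z z01 <-]; move: z01; rewrite /= in_itv/= => z01.
have /andP[a0 a1] := a_itv R mu n mu0 z z01; have /andP[z0 z1] := z01.
by rewrite ler_norml; apply/andP; split; lra.
Qed.

Section smooth.
Variables (R : realType) (mu : R) (g : R -> R).
Hypotheses (mu0 : 0 < mu) (C1g : C1 g).

(** A Lipschitz constant of [fmu mu g] on [0, 1], linear in the C^1 norm of g. *)
Let G := (1 + 1 / ((1 + mu) * ln (1 + mu))) / ln (1 + mu) * C1norm g.

Let mu1 : 0 < 1 + mu. Proof. by rewrite addr_gt0. Qed.

Let l0 : 0 < ln (1 + mu). Proof. exact: ln1mu_gt0. Qed.

Lemma C1_continuous : continuous g.
Proof.
by move=> x; apply: differentiable_continuous; apply/derivable1_diffP; exact: C1g.1.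
Qed.

Lemma le_supnorm_C1 (x : R) : 0 <= x <= 1 -> `|g x| <= supnorm01 g.
Proof.
by move=> x01; apply: le_supnorm01 => //; apply: continuous_subspaceT; exact: C1_continuous.
Qed.

Lemma le_supnorm_C1' (x : R) : 0 <= x <= 1 -> `|derive1 g x| <= supnorm01 (derive1 g).
Proof.
by move=> x01; apply: le_supnorm01 => //; apply: continuous_subspaceT; exact: C1g.2.
Qed.

Lemma is_derive_fmu (x : R) : 0 <= x ->
  is_derive x 1 (fmu mu g)
    (derive1 g x / lnmu mu x - g x / ((1 + mu + x) * lnmu mu x ^+ 2)).
Proof.
move=> x0; have L0 : lnmu mu x != 0 by rewrite gt_eqF// lnmu_gt0.
have p0 : 1 + mu + x != 0 by rewrite gt_eqF// ltr_wpDr.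
have hg : is_derive x 1 g (derive1 g x).
  by rewrite derive1E; apply: derivableP; exact: C1g.1.
have hl := is_deriveV L0 (is_derive_lnmu R mu mu0 x x0).
apply: is_derive_eq (is_deriveM hg hl) _.
by rewrite /GRing.scale/=; field; rewrite L0 p0.
Qed.

Lemma normr_derive_fmu_le (x : R) : 0 <= x <= 1 ->
  `|derive1 g x / lnmu mu x - g x / ((1 + mu + x) * lnmu mu x ^+ 2)| <= G.
Proof.
move=> x01; have [x0 x1] := andP x01.
have L0 := lnmu_gt0 R mu mu0 x x0; have Ll := lnmu_ge R mu mu0 x x0.
have s0 : 0 <= supnorm01 g by exact: le_trans (le_supnorm_C1 x x01).
have s1 : 0 <= supnorm01 (derive1 g) by exact: le_trans (le_supnorm_C1' x x01).
apply: (le_trans (ler_normB _ _)).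
apply: (@le_trans _ _ (supnorm01 (derive1 g) / ln (1 + mu) +
    supnorm01 g / ((1 + mu) * ln (1 + mu) ^+ 2))).
  apply: lerD; rewrite normrM normfV.
    apply: ler_pM; rewrite ?invr_ge0//; first exact: le_supnorm_C1'.
    by rewrite gtr0_norm// lef_pV2 ?posrE.
  have q0 : 0 < 1 + mu + x by rewrite ltr_wpDr.
  apply: ler_pM; rewrite ?invr_ge0//; first exact: le_supnorm_C1.
  rewrite gtr0_norm; last by rewrite mulr_gt0// exprn_gt0.
  rewrite lef_pV2 ?posrE ?mulr_gt0 ?exprn_gt0//.
  apply: ler_pM; rewrite ?sqr_ge0 ?(ltW mu1)//; first by rewrite lerDl.
  by rewrite ler_sqr ?nnegrE// ltW.
(* Expanding G gives four nonnegative terms, two of which are those just obtained. *)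
rewrite -subr_ge0 /G /C1norm.
set s := supnorm01 g in s0 *; set s' := supnorm01 _ in s1 *.
have -> : (1 + 1 / ((1 + mu) * ln (1 + mu))) / ln (1 + mu) * (s + s') -
    (s' / ln (1 + mu) + s / ((1 + mu) * ln (1 + mu) ^+ 2)) =
    s / ln (1 + mu) + s' / ((1 + mu) * ln (1 + mu) ^+ 2).
  by field; rewrite !gt_eqF.
by rewrite addr_ge0// divr_ge0 ?mulr_ge0 ?sqr_ge0// ltW.
Qed.

Lemma fmu_lipschitz (x t : R) : 0 <= x <= 1 -> 0 <= t <= 1 ->
  `|fmu mu g t - fmu mu g x| <= G * `|t - x|.
Proof.
wlog xt : x t / x <= t.
  move=> H x01 t01; have [xt|/ltW tx] := leP x t; first exact: H.
  by rewrite distrC (distrC t); exact: H.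
move=> /andP[x0 x1] /andP[t0 t1].
have sub z : z \in `[x, t] -> 0 <= z <= 1.
  by rewrite in_itv/= => /andP[xz zt]; rewrite (le_trans x0)//= (le_trans zt).
have df z : z \in `]x, t[ -> is_derive z 1 (fmu mu g)
    (derive1 g z / lnmu mu z - g z / ((1 + mu + z) * lnmu mu z ^+ 2)).
  by move=> /subset_itv_oo_cc/sub/andP[z0 _]; exact: is_derive_fmu.
have cf : {within `[x, t], continuous (fmu mu g)}.
  apply: derivable_within_continuous => z /sub/andP[z0 _].
  by have [] := is_derive_fmu z z0.
have [c /sub c01 ->] := MVT_segment xt df cf.
by rewrite normrM; apply: ler_wpM2r => //; exact: normr_derive_fmu_le.
Qed.

Lemma C1_int01 : int01 R g.
Proof.
apply: continuous_compact_integrable; first exact: segment_compact.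
by apply: continuous_subspaceT; exact: C1_continuous.
Qed.

Lemma normr_LK_sub_le (n : nat) (x : R) : 0 <= x <= 1 ->
  `|LK mu n g x - g x| <= ln (2 + mu) * (G * T_ mu n).
Proof.
move=> x01; have [x0 x1] := andP x01.
have a01 := a_itv R mu n mu0 x x01.
have L0 := lnmu_gt0 R mu mu0 x x0.
have G0 : 0 <= G.
  by apply: le_trans (normr_derive_fmu_le x x01); exact: normr_ge0.
have m0 : 0 < n.+1%:R :> R by rewrite ltr0n.
(* Since g x is [lnmu mu x] times [fmu mu g x], the factor [lnmu mu x] comes out and a pure
   averaging error remains. *)
have -> : LK mu n g x - g x =
    lnmu mu x * (Kant R n (a_ mu n.+1 x) (fmu mu g) - fmu mu g x).
  by rewrite mulrBr {2}/fmu mulrCA divff ?mulr1// gt_eqF.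
rewrite normrM (gtr0_norm L0).
apply: ler_pM => //; [exact: ltW|exact: lnmu_le|].
set m : R := n.+1%:R in m0 *.
pose d k := G * ((1 / (2 * m) + gamma_ mu n) + `|(k%:R + 2^-1) / m - a_ mu n.+1 x|).
apply: (@le_trans _ _ (\sum_(0 <= k < n.+1) pnk n k (a_ mu n.+1 x) * d k)).
  apply: Kant_near => //; first by apply: int01_fmu => //; exact: C1_int01.
  move=> k t kn tk.
  have t01 : 0 <= t <= 1 by have := cell_sub R n k kn t tk; rewrite /= in_itv.
  apply: (le_trans (fmu_lipschitz x t x01 t01)); apply: ler_wpM2l => //.
  (* The three differences are t to the cell midpoint, at most 1 / (2 m); a x to x, at most gamma;
     and midpoint to a x, kept for the Bernstein average. *)
  have -> : t - x = (t - (k%:R + 2^-1) / m) + (a_ mu n.+1 x - x) +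
      ((k%:R + 2^-1) / m - a_ mu n.+1 x) by ring.
  apply: (le_trans (ler_normD _ _)); rewrite lerD2r.
  apply: (le_trans (ler_normD _ _)); apply: lerD; last exact: le_gamma_.
  move: tk; rewrite in_itv/= -/m -natr1 => /andP[tk tk'].
  have -> : (k%:R + 2^-1) / m = k%:R / m + 1 / (2 * m) by field; rewrite gt_eqF.
  have tk2 : t <= k%:R / m + 1 / (2 * m) + 1 / (2 * m).
    apply: (le_trans tk'); rewrite le_eqVlt; apply/orP; left; apply/eqP.
    by field; rewrite gt_eqF.
  move: (k%:R / m) (1 / (2 * m)) tk tk2 => q e qt te.
  rewrite ler_norml; apply/andP; split; lra.
under eq_bigr do rewrite /d mulrCA mulrDr.
rewrite -mulr_sumr; apply: ler_wpM2l => //.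
rewrite big_split/= -mulr_suml sum_pnk mul1r /T_ -/m.
by rewrite [leRHS]addrAC lerD2l; exact: sum_pnk_absdist.
Qed.

End smooth.

(** * From C^1 functions to L^p through the K-functional *)

Section assembly.
Variables (R : realType) (mu p : R).
Hypotheses (mu0 : 0 < mu) (p1 : 1 <= p).

(** The majorant 1 + |f|^p is integrable on [0, 1] and dominates |f|. *)
Lemma inLp_int01 (f : R -> R) : inLp p f -> int01 R f.
Proof.
move=> [mf fp].
have ip : int01 R (fun x => 1 + `|f x| `^ p).
  apply: int01D; first exact: int01_cst.
  apply/integrableP; split.
    by apply/measurable_EFinP; exact: measurable_normr_powR.
  apply: le_lt_trans fp; rewrite le_eqVlt; apply/orP; left; apply/eqP.
  by apply: eq_integral => x _; rewrite poweR_EFin /= ger0_norm ?powR_ge0.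
apply: (le_integrable (measurable01 R) _ _ ip); first exact/measurable_EFinP.
move=> x _; rewrite lee_fin [leRHS]ger0_norm ?addr_ge0 ?powR_ge0//.
have [f1|/ltW f1] := leP `|f x| 1; first by rewrite ler_wpDr ?powR_ge0.
by rewrite ler_wpDl//; exact: le1r_powR.
Qed.

Lemma LKB (n : nat) (f g : R -> R) (x : R) : int01 R f -> int01 R g ->
  LK mu n (fun t => f t - g t) x = LK mu n f x - LK mu n g x.
Proof.
move=> /(int01_fmu R mu mu0) iF /(int01_fmu R mu mu0) iG.
rewrite -[LHS]/(lnmu mu x * Kant R n (a_ mu n.+1 x) _) -mulrBr; congr (_ * _).
have -> : fmu mu (fun t => f t - g t) = fun t => fmu mu f t + -1 * fmu mu g t.
  by apply/funext => t; rewrite /fmu; ring.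
by rewrite KantD//; [rewrite KantZ// mulN1r|exact: int01Z].
Qed.

(** With N the norm of f - g, the three pieces of the splitting contribute rho [Kmu mu] N, a uniform
    bound B for the smooth error, and N; rho >= 1 absorbs the last two into the stated constant. *)
Lemma Lpnorm_LK_sub_le (n : nat) (f g : R -> R) : inLp p f -> C1 g ->
  (Lpnorm p (fun x => LK mu n f x - f x)%R <=
   (ln (2 + mu) / ln (1 + mu) * (Kmu mu + 1))%:E *
   (Lpnorm p (fun x => f x - g x)%R + (Lambda_ mu n * C1norm g)%:E))%E.
Proof.
move=> fp C1g; have ifx := inLp_int01 f fp; have igx := C1_int01 R g C1g.
set rho := ln (2 + mu) / ln (1 + mu).
have l0 := ln1mu_gt0 R mu mu0.
have mu1 : 0 < 1 + mu by rewrite addr_gt0.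
have rho1 : 1 <= rho.
  rewrite ler_pdivlMr// mul1r ler_ln ?posrE//; last by rewrite addr_gt0.
  by rewrite lerD2r ler1n.
have K0 : 0 < Kmu mu + 1 by rewrite /Kmu !addr_gt0// divr_gt0.
have rho0 : 0 < rho by exact: lt_le_trans rho1.
have c0 : 0 < rho * (Kmu mu + 1) by rewrite mulr_gt0.
have p0 : 0 < p by exact: lt_le_trans p1.
have ifg : int01 R (fun x => f x - g x).
  have := int01D R _ _ ifx (int01Z R (-1) _ igx).
  by apply: eq_integrable => // t _; rewrite /= mulN1r.
have mfg : measurable_fun (`[0, 1] : set R) (fun x => f x - g x).
  by apply/measurable_EFinP; exact: (measurable_int _ ifg).
have N0 : (0 <= Lpnorm p (fun x => f x - g x)%R)%E by exact: poweR_ge0.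
(* If the norm is infinite, so is the right side, its constant being positive; otherwise |f - g|^p
   is integrable, as the L^p bound on the operator requires. *)
have [Ny|Nlty] := eqVneq (Lpnorm p (fun x => f x - g x)) +oo%E.
  by rewrite Ny addye// gt0_muley ?lte_fin// leey.
have ifgp : int01 R (fun x => `|f x - g x| `^ p).
  apply/integrableP; split.
    by apply/measurable_EFinP; exact: measurable_normr_powR.
  apply: (@lty_poweRy _ _ p^-1); first by rewrite invr_eq0 gt_eqF.
  move: Nlty; rewrite -ltey LpnormE; apply: le_lt_trans.
  rewrite le_eqVlt; apply/orP; left; apply/eqP; congr (_ `^ _)%E.
  by apply: eq_integral => x _; rewrite /= ger0_norm ?powR_ge0.
set N := Lpnorm p (fun x => f x - g x) in N0 Nlty *.
have mg : measurable_fun (`[0, 1] : set R) g.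
  by apply/measurable_EFinP; exact: (measurable_int _ igx).
have mLg : measurable_fun (`[0, 1] : set R) (fun x => LK mu n g x - g x).
  by apply: measurable_funB => //; exact: measurable_LK.
have -> : (fun x => LK mu n f x - f x) =
    (fun x => LK mu n (fun t => f t - g t) x +
      ((LK mu n g x - g x) + (g x - f x))).
  by apply/funext => x; rewrite LKB//; ring.
have mgf : measurable_fun (`[0, 1] : set R) (fun x => g x - f x).
  by apply: measurable_funB => //; exact: fp.1.
have Ngf : Lpnorm p (fun x => g x - f x) = N.
  by rewrite /N !LpnormE; congr (_ `^ _)%E; apply: eq_integral => x _; rewrite distrC.
set B := ln (2 + mu) * ((1 + 1 / ((1 + mu) * ln (1 + mu))) / ln (1 + mu) *
  C1norm g * T_ mu n).
have B0 : 0 <= B.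
  (* B dominates an absolute value, here taken at the point 0. *)
  by apply: le_trans (normr_LK_sub_le R mu g mu0 C1g n 0 _); rewrite ?lexx ?ler01.
apply: (@le_trans _ _ ((rho * Kmu mu)%:E * N + (B%:E + N))%E).
  apply: le_trans (LpnormD _ _ p1 _ _ _ _) _.
  - exact: measurable_LK.
  - exact: measurable_funD.
  apply: leeD; first exact: Lpnorm_LK.
  apply: le_trans (LpnormD _ _ p1 _ _ _ _) _ => //.
  rewrite Ngf; apply: leeD => //; apply: Lpnorm_le_cst => // x x01.
  exact: normr_LK_sub_le.
have Nfin : N \is a fin_num by rewrite ge0_fin_numE// ltey.
rewrite -(fineK Nfin) -!EFinM -!EFinD lee_fin.
set N' := fine N.
have N'0 : 0 <= N' by exact: fine_ge0.
have BL : B <= rho * (Kmu mu + 1) * (Lambda_ mu n * C1norm g).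
  (* The factor ([Kmu mu] + 1)^-1 in [Lambda_] cancels, and what remains exceeds B only by the
     factor rho. *)
  have -> : rho * (Kmu mu + 1) * (Lambda_ mu n * C1norm g) = rho * B.
    rewrite /Lambda_ -/rho /B.
    have -> : ln (2 + mu) = rho * ln (1 + mu) by rewrite divfK// gt_eqF.
    by field; rewrite !gt_eqF.
  by rewrite ler_peMl.
rewrite (mulrDr _ N').
have -> : rho * (Kmu mu + 1) * N' = rho * Kmu mu * N' + rho * N' by ring.
by rewrite -addrA lerD2l addrC lerD// ler_peMl.
Qed.

End assembly.

Theorem theorem6p2 (R : realType) (mu p : R) (f : R -> R) :
  0 < mu -> 1 <= p -> inLp p f ->
  exists N : nat, forall n : nat, (N <= n)%N ->
    (Lpnorm p ((fun x => LK mu n f x - f x)%R) <=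
     ((ln (2 + mu) / ln (1 + mu) * (Kmu mu + 1))%:E * Kfun p f (Lambda_ mu n)))%E.
Proof.
(* The estimate holds for every n, so the threshold is 0. *)
move=> mu0 p1 fp; exists 0%N => n _.
have c0 : 0 < ln (2 + mu) / ln (1 + mu) * (Kmu mu + 1).
  have mu1 : 0 < 1 + mu by rewrite addr_gt0.
  rewrite mulr_gt0 ?divr_gt0 ?ln_gt0 ?ltrDl//.
    by rewrite ltr_wpDr ?ltr1n// ltW.
  by rewrite /Kmu !addr_gt0// divr_gt0.
(* A positive constant passes inside the infimum, which reduces the claim to one function g at a
   time. *)
rewrite /Kfun -ereal_inf_pZl//; apply/ereal_infP => _ [_ [g C1g <-] <-].
exact: Lpnorm_LK_sub_le.
Qed.
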